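(* Let $H,H'\in\mathbf{K}$ be non-homeomorphic. Then (a) the sets $\mathrm{Shrp}^H$ and $\mathrm{Shrp}^{H'}$ are disjoint and Borel-inseparable, and (b) the sets $\mathrm{Blr}^H$ and $\mathrm{Blr}^{H'}$ are disjoint and Borel-inseparable; here Borel-inseparable means there is no Borel subset of $\mathbf{K}$ containing the first set and disjoint from the second.
   Context: $2^{\omega}$ is the Cantor space; $N_s=\{x\in2^\omega:s\subset x\}$; $\mu$ is the coin-tossing measure, $\mu(N_s)=2^{-\mathrm{lh}(s)}$. For measurable $A$, $\mathcal{D}_A(z)=\lim_n\mu(A\cap N_{z\restriction n})/\mu(N_{z\restriction n})$ when it exists. $\mathrm{Blur}(A)$ is the set of $z$ where $\mathcal{D}_A(z)$ does not exist; $\mathrm{Sharp}(A)$ is the set of $z$ where it exists and lies in $(0;1)$. $\mathbf{K}$ is the Polish space of compact subsets of $2^\omega$ with the Vietoris topology. For $H\in\mathbf{K}$: $\mathrm{Shrp}^H=\{K\in\mathbf{K}:\mathrm{Sharp}(K)\text{ homeomorphic to }H\}$, $\mathrm{Blr}^H=\{K\in\mathbf{K}:\mathrm{Blur}(K)\text{ homeomorphic to }H\}$. *)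

(* Defs.v *)
From HB Require Import structures.
From mathcomp Require Import all_boot all_order all_algebra.
From mathcomp Require Import all_classical all_reals all_analysis.
Set Implicit Arguments. Unset Strict Implicit. Unset Printing Implicit Defensive.
Import Order.TTheory GRing.Theory Num.Theory.
Import numFieldNormedType.Exports.
Local Open Scope classical_set_scope.
Local Open Scope ring_scope.

Definition Ncyl (s : seq bool) : set cantor_space :=
  [set x | forall i, (i < size s)%N -> x i = nth false s i].

Definition restr (z : cantor_space) (n : nat) : seq bool := mkseq z n.

(* The coin-tossing measure (as an outer measure, hence defined on every set):
   mu(A) = inf { sum_k 2^-(lh s_k) | A is covered by the cylinders N_{s_k} }.
   On Borel sets this is the product (coin-tossing) measure with
   mu(N_s) = 2^-lh(s). *)
Definition mu (R : realType) (A : set cantor_space) : \bar R :=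
  ereal_inf [set (\sum_(0 <= k <oo) ((2%:R ^- size (s k))%:E))%E
            | s in [set s : nat -> seq bool | A `<=` \bigcup_k Ncyl (s k)]].

Definition dens_seq (R : realType) (A : set cantor_space) (z : cantor_space)
  : nat -> R :=
  fun n => fine (mu R (A `&` Ncyl (restr z n))) / fine (mu R (Ncyl (restr z n))).

Definition Blur (R : realType) (A : set cantor_space) : set cantor_space :=
  [set z | ~ cvgn (dens_seq R A z)].

Definition Sharp (R : realType) (A : set cantor_space) : set cantor_space :=
  [set z | cvgn (dens_seq R A z) /\ 0 < limn (dens_seq R A z) < 1].

Definition homeomorphic (A B : set cantor_space) : Prop :=
  exists (f g : cantor_space -> cantor_space),
    (forall x, A x -> B (f x)) /\ (forall y, B y -> A (g y)) /\
    (forall x, A x -> g (f x) = x) /\ (forall y, B y -> f (g y) = y) /\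
    {within A, continuous f} /\ {within B, continuous g}.

Definition Kspace : set (set cantor_space) := [set K | compact K].

Definition vietoris_subbasic (b : bool) (U : set cantor_space)
  : set (set cantor_space) :=
  Kspace `&` (if b then [set K | K `<=` U] else [set K | K `&` U !=set0]).

Definition vietoris_open (O : set (set cantor_space)) : Prop :=
  O `<=` Kspace /\
  forall K, O K -> exists l : seq (bool * set cantor_space),
    (forall p, p \in l -> open p.2) /\
    let V := Kspace `&` [set K' | forall p, p \in l -> vietoris_subbasic p.1 p.2 K'] in
    V K /\ V `<=` O.

Definition KBorel : set (set (set cantor_space)) := <<s Kspace, vietoris_open >>.

Definition Shrp (R : realType) (H : set cantor_space) : set (set cantor_space) :=
  [set K | Kspace K /\ homeomorphic (Sharp R K) H].

Definition Blr (R : realType) (H : set cantor_space) : set (set cantor_space) :=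
  [set K | Kspace K /\ homeomorphic (Blur R K) H].

Definition borel_inseparable (X Y : set (set cantor_space)) : Prop :=
  ~ exists B, KBorel B /\ X `<=` B /\ B `&` Y = set0.

(* Main.v *)
(** Disjointness holds because homeomorphism is an equivalence relation.
    Inseparability is a diagonal argument.  Every Borel [D] in the Cantor space
    is [{x | f x 0}] for some [f] with Gdelta graph, hence
    [F x = {f x} * (H' if f x 0, H otherwise)] has Gdelta graph and sections
    homeomorphic to [H'] over [D] and to [H] off [D].

    A Gdelta set is the set of [z] along which an integer-valued rank of the
    restrictions of [z] tends to infinity.  Such a set is realised, up to
    homeomorphism, as [Sharp K] or as [Blur K]: [K] consists of a null perfect
    set, the spine, together with clopen pieces attached at the exits of the
    spine.  If the density of [K] converges at a spine point, then so do the
    densities of the pieces met along the way.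
    - For [Sharp], the pieces alternately have density [1/2] and
      [1/2 + 2 ^- (rank + 2)], so the density converges, to [1/2], exactly where
      the rank tends to infinity.
    - For [Blur], the pieces are empty except that each jump of the rank puts in
      a full one, so the density converges, to [0], exactly where the rank is
      bounded.
    The compact set depends continuously on the code of the Gdelta set, which is
    what makes the preimage of a separating Borel set available to the diagonal
    argument. *)
Require Import Defs.
From HB Require Import structures.
From mathcomp Require Import all_boot all_order all_algebra.
From mathcomp Require Import all_classical all_reals all_analysis.
From mathcomp Require Import lra.
Set Implicit Arguments.
Unset Strict Implicit.
Unset Printing Implicit Defensive.
Import Order.TTheory GRing.Theory Num.Theory.
Import numFieldNormedType.Exports.
Local Open Scope classical_set_scope.
Local Open Scope ring_scope.

Local Notation X := cantor_space.

(** * Cylinders *)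

Lemma Ncyl_nil : Ncyl [::] = setT.
Proof. by apply/seteqP; split. Qed.

Lemma Ncyl_rcons (s : seq bool) (b : bool) (x : X) :
  Ncyl (rcons s b) x <-> Ncyl s x /\ x (size s) = b.
Proof.
rewrite /Ncyl /= size_rcons; split=> [h|[h <-] i].
  split=> [i il|]; last by rewrite h// nth_rcons ltnn eqxx.
  by rewrite h ?ltnS 1?ltnW// nth_rcons il.
by rewrite ltnS leq_eqVlt nth_rcons => /predU1P[->|il]; rewrite ?ltnn ?eqxx// il h.
Qed.

Lemma Ncyl_restr (z : X) (n : nat) (x : X) :
  Ncyl (restr z n) x <-> forall i, (i < n)%N -> x i = z i.
Proof.
rewrite /Ncyl /restr /= size_mkseq.
by split=> h i il; move: (h i il); rewrite nth_mkseq.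
Qed.

Lemma NcylP (s : seq bool) (x : X) : Ncyl s x <-> restr x (size s) = s.
Proof.
split=> [h|<-]; last by apply/Ncyl_restr.
apply: (@eq_from_nth _ false); rewrite size_mkseq// => i il.
by rewrite nth_mkseq// h.
Qed.

Lemma Ncyl_self (z : X) (n : nat) : Ncyl (restr z n) z.
Proof. exact/Ncyl_restr. Qed.

Lemma restrS (z : X) n : restr z n.+1 = rcons (restr z n) (z n).
Proof. by rewrite /restr mkseqS. Qed.

Lemma size_restr (z : X) n : size (restr z n) = n.
Proof. exact: size_mkseq. Qed.

Lemma Ncyl_restr_sub (x : X) m n : (m <= n)%N ->
  Ncyl (restr x n) `<=` Ncyl (restr x m).
Proof.
by move=> mn y /Ncyl_restr yx; apply/Ncyl_restr => i im; apply/yx/(leq_trans im).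
Qed.

Lemma Ncyl_restr_trans (x y : X) n m : (n <= m)%N -> Ncyl (restr x n) y ->
  Ncyl (restr y m) `<=` Ncyl (restr x n).
Proof.
move=> nm /Ncyl_restr yx w /Ncyl_restr wy; apply/Ncyl_restr => i il.
by rewrite wy ?yx// (leq_trans il).
Qed.

Lemma eq_restr (x y : X) n : Ncyl (restr x n) y -> restr y n = restr x n.
Proof. by move=> /NcylP; rewrite size_restr. Qed.

Lemma nbhs_cantorP (x : X) (U : set X) :
  nbhs x U <-> exists n, Ncyl (restr x n) `<=` U.
Proof.
split; last first.
  case=> n nU; apply: filterS nU _; elim: n {U} => [|n IH].
    by rewrite Ncyl_nil; exact: filterT.
  have px : nbhs x [set y : X | y n = x n].
    by apply: (@proj_continuous nat (fun=> bool) n x [set x n]); exact: discrete_set1.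
  apply: filterS (filterI IH px) => y [/= yx yn].
  by rewrite restrS; apply/Ncyl_rcons; rewrite size_restr.
(* The claim is that this filter of cylinders converges to [x]; in the product topology this is
   checked one coordinate at a time. *)
pose F : set_system X := [set V | exists n, Ncyl (restr x n) `<=` V].
have FF : Filter F.
  split=> [|P Q [n nP] [m mQ]|P Q PQ [n nP]].
  - by exists 0%N.
  - exists (maxn n m) => y yx; split; [apply: nP | apply: mQ].
      by apply: Ncyl_restr_sub yx; rewrite leq_maxl.
    by apply: Ncyl_restr_sub yx; rewrite leq_maxr.
  - by exists n; apply: subset_trans PQ.
suff : F --> x by apply.
apply/cvg_sup => i V [/= W [[B oB <-] Bx] BV].
exists i.+1 => y /Ncyl_restr yx; apply: BV; rewrite /= /proj.
by rewrite yx.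
Qed.

(** * The coin-tossing measure *)

Lemma small_halves (R : realType) (e : R) : 0 < e ->
  exists M, forall n, (M <= n)%N -> 2%:R ^- n <= e.
Proof.
move=> e0; have : geometric 1 (2^-1 : R) @ \oo --> (0 : R).
  by apply: cvg_geometric; rewrite ger0_norm ?invr_ge0// invf_lt1 ?ltr1n.
move/cvgr0_norm_le => /(_ _ e0)[M _ small]; exists M => n /small /=.
by rewrite mul1r exprVn ger0_norm ?invr_ge0 ?exprn_ge0.
Qed.

Section CoinTossing.
Variable R : realType.

Local Notation wt s := ((2%:R ^- size s)%:E : \bar R).

(* Covers in [mu] are indexed by all of [nat]; the unused indices are filled
   with cylinders of total measure [2 ^- M]. *)
Lemma mu_le_cover (A : set X) (P : pred nat) (s : nat -> seq bool) :
  A `<=` \bigcup_(k in [set k | P k]) Ncyl (s k) ->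
  (mu R A <= \sum_(0 <= k <oo | P k) wt (s k))%E.
Proof.
move=> As; apply/lee_addgt0Pr => e e0.
have [M /(_ M (leqnn M)) Me] := small_halves e0.
pose s' k := if P k then s k else nseq (k + M.+1) false.
apply: (@le_trans _ _ (\sum_(0 <= k <oo) wt (s' k))%E).
  apply: ge_ereal_inf; exists (\sum_(0 <= k <oo) wt (s' k))%E => //.
  exists s' => // x /As[k /= Pk xk]; exists k => //.
  by rewrite /s' Pk.
pose f k : \bar R := if P k then wt (s k) else 0%E.
have f0 k : (0 <= f k)%E by rewrite /f; case: ifP.
pose g k : \bar R := ((1 / (2 ^ (k + M.+1))%:R)%:E)%E.
have g0 k : (0 <= g k)%E by rewrite /g lee_fin divr_ge0.
apply: (@le_trans _ _ (\sum_(0 <= k <oo) (f k + g k))%E).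
  apply: lee_nneseries => // k _; rewrite /f /g /s'; case: ifP => Pk.
    by rewrite leeDl.
  by rewrite add0e size_nseq natrX mul1r.
rewrite nneseriesD//; apply: leeD.
  by rewrite [leRHS]eseries_mkcond.
rewrite (_ : (\sum_(0 <= k <oo) g k)%E = (2%:R ^- M)%:E) ?lee_fin//.
have /cvg_lim := @cvg_geometric_eseries_half R 1 M.
by rewrite mul1r; apply.
Qed.

Lemma mu_le (A B : set X) : A `<=` B -> (mu R A <= mu R B)%E.
Proof.
by move=> AB; apply: ereal_inf_le_tmp => _ [s Bs <-]; exists s => //; exact: subset_trans Bs.
Qed.

Lemma mu_ge0 (A : set X) : (0 <= mu R A)%E.
Proof.
by apply: le_ereal_inf_tmp => _ [s _ <-]; apply: nneseries_ge0.
Qed.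

Lemma mu0 : mu R set0 = 0%E.
Proof.
apply/eqP; rewrite eq_le mu_ge0 andbT.
apply: le_trans (@mu_le_cover set0 xpred0 (fun=> [::]) _) _ => //.
by rewrite eseries_pred0.
Qed.

Lemma mu_Ncyl_le (s : seq bool) : (mu R (Ncyl s) <= wt s)%E.
Proof.
apply: le_trans (@mu_le_cover (Ncyl s) (pred1 0%N) (fun=> s) _) _.
  by move=> x xs; exists 0%N.
apply: lime_le; first by apply: is_cvg_nneseries => *.
apply: nearW => -[|n]; first by rewrite big_geq.
rewrite big_mkcond big_ltn//= big_nat_cond big1 ?adde0//.
by case=> //= i; rewrite andbF.
Qed.

(** Induction on how much the longest word of [l] exceeds [s]. A word no longer than [s] already
    weighs enough; if all are longer, their bit at position [size s] splits [l] into covers of the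
    two halves of [Ncyl s]. *)
Lemma finite_cover_wt (l : seq (seq bool)) (s : seq bool) :
  Ncyl s `<=` [set x | exists2 t, t \in l & Ncyl t x] ->
  2%:R ^- size s <= \sum_(t <- l) 2%:R ^- size t :> R.
Proof.
have p0 n : 0 <= 2%:R ^- n :> R by rewrite invr_ge0 exprn_ge0.
have short (l' : seq (seq bool)) (r : seq bool) :
    has (fun t => size t <= size r)%N l' ->
    2%:R ^- size r <= \sum_(t <- l') 2%:R ^- size t :> R.
  case/hasP => t tl tr; rewrite (big_rem t)//=.
  apply: (@le_trans _ _ (2%:R ^- size t)); last by rewrite lerDl sumr_ge0.
  by rewrite lef_pV2 ?posrE ?exprn_gt0// ler_eXn2l// ltr1n.
have [j lj] : exists j, all (fun t => size t <= size s + j)%N l.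
  elim: l => [|t l [j IH]]; first by exists 0%N.
  exists (size t + j)%N => /=; rewrite addnCA leq_addr/=.
  by apply: sub_all IH => u; move/leq_trans; apply; exact: leq_addl.
elim: j s l lj => [|j IH] s l lj sl.
  have [t tl _] := sl (fun i => nth false s i) (fun i _ => erefl).
  by apply: short; apply/hasP; exists t => //; rewrite -[leqRHS]addn0; apply: (allP lj).
have [/short//|/hasPn long] := boolP (has (fun t => size t <= size s)%N l).
have half : 2%:R ^- (size s).+1 + 2%:R ^- (size s).+1 = 2%:R ^- size s :> R.
  by rewrite exprS invfM -mulrDl -[X in X + X]mul1r -splitr mul1r.
pose q b : pred (seq bool) := fun t => nth false t (size s) == b.
have piece b : 2%:R ^- (size s).+1 <= \sum_(t <- [seq t <- l | q b t]) 2%:R ^- size t :> R.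
  rewrite -(size_rcons s b); apply: IH => [|x /Ncyl_rcons[xs xb]].
    rewrite size_rcons addSnnS; apply/allP => t; rewrite mem_filter => /andP[_].
    exact: (allP lj).
  have [t tl tx] := sl _ xs; exists t => //; rewrite mem_filter tl andbT /q.
  by rewrite -tx ?xb// ltnNge; exact: long.
rewrite -half (bigID (q true))/= -big_filter lerD//.
apply: le_trans (piece false) _; rewrite le_eqVlt; apply/orP; left; apply/eqP.
rewrite big_filter; apply: eq_bigl => t; by rewrite /q; case: nth.
Qed.

Lemma mu_Ncyl (s : seq bool) : mu R (Ncyl s) = wt s.
Proof.
apply/eqP; rewrite eq_le mu_Ncyl_le; apply: le_ereal_inf_tmp => _ [t st <-].
(* Compactness makes the cover finite: near each point, membership in one of the first [n] cylinders
   holds for all large [n], so a single [n] serves everywhere. *)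
have /compact_near_coveringP := cantor_space_compact.
move=> /(_ nat \oo (fun n x => Ncyl s x -> exists2 k, (k < n)%N & Ncyl (t k) x)).
case=> [x _|n _ /(_ n (leqnn n)) nt].
  have [sx|nsx] := pselect (Ncyl s x).
    have [k _ kx] := st _ sx.
    exists (Ncyl (restr x (size (t k))), [set n | k < n]%N).
      by split; [apply/nbhs_cantorP; exists (size (t k)) | exists k.+1].
    move=> [y m] [/= + km] _; rewrite (iffLR (NcylP _ _) kx) => ky.
    by exists k.
  exists (Ncyl (restr x (size s)), setT) => [|[y m] [/= yx _] ys].
    by split; [apply/nbhs_cantorP; exists (size s) | exact: filterT].
  by case: nsx; apply/NcylP; rewrite -(eq_restr yx); apply/NcylP.
apply: (@le_trans _ _ (\sum_(0 <= k < n) wt (t k))%E); last exact: nneseries_lim_ge.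
rewrite sumEFin lee_fin -(big_map t predT (fun t => 2%:R ^- size t)).
apply: finite_cover_wt => x sx; have [//|k kn kx] := nt x _ sx.
by exists (t k) => //; apply: map_f; rewrite mem_index_iota.
Qed.

(** Holds for arbitrary [A] because the two halves are separated by a clopen set: any cover of the
    whole can be cut along it, and near-optimal covers of the halves can be merged. *)
Lemma mu_split (A : set X) (s : seq bool) :
  mu R (A `&` Ncyl s) =
  (mu R (A `&` Ncyl (rcons s false)) + mu R (A `&` Ncyl (rcons s true)))%E.
Proof.
apply/eqP; rewrite eq_le; apply/andP; split; last first.
  apply: le_ereal_inf_tmp => _ [t st <-].
  (* A word no longer than [s] is replaced by [rcons s b] in each half, at total cost [2 ^- size s];
     a longer word is kept only on the side named by its bit at [size s]. *)
  pose P b k := (size (t k) <= size s)%N || (nth false (t k) (size s) == b).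
  pose t' b k := if (size (t k) <= size s)%N then rcons s b else t k.
  have cov b : (mu R (A `&` Ncyl (rcons s b)) <= \sum_(0 <= k <oo | P b k) wt (t' b k))%E.
    apply: mu_le_cover => x [Ax xsb]; have /Ncyl_rcons[xs xb] := xsb.
    have [k _ kx] := st x (conj Ax xs); exists k; rewrite /= /P /t'; case: leqP => //= tk.
    by rewrite -kx// xb.
  apply: le_trans (leeD (cov false) (cov true)) _.
  rewrite [X in (X + _)%E]eseries_mkcond [X in (_ + X)%E]eseries_mkcond -nneseriesD; last 2 first.
  - by move=> k _ _; case: ifP.
  - by move=> k _ _; case: ifP.
  apply: lee_nneseries => [k _ _|k _]; first by apply: adde_ge0; case: ifP.
  rewrite /P /t'; case: leqP => /= tk; last by case: nth; rewrite /= ?adde0 ?add0e.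
  rewrite !size_rcons -EFinD lee_fin exprS invfM -mulrDl -[X in X + X]mul1r -splitr mul1r.
  by rewrite lef_pV2 ?posrE ?exprn_gt0// ler_eXn2l// ltr1n.
have fin b : mu R (A `&` Ncyl (rcons s b)) \is a fin_num.
  rewrite ge0_fin_numE ?mu_ge0//.
  apply: le_lt_trans (mu_le (@subIsetr _ _ _)) _.
  by rewrite mu_Ncyl ltry.
apply/lee_addgt0Pr => e e0.
have e20 : 0 < e / 2 by rewrite divr_gt0.
have [_ [t0 c0 <-] m0] := lb_ereal_inf_adherent e20 (fin false).
have [_ [t1 c1 <-] m1] := lb_ereal_inf_adherent e20 (fin true).
(* The two covers are interleaved, so [n.*2] terms of [t] are [n] terms of each. *)
pose t k := if odd k then t1 k./2 else t0 k./2.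
rewrite [e]splitr EFinD addeACA; apply: le_trans (leeD (ltW m0) (ltW m1)).
apply: le_trans (@mu_le_cover _ xpredT t _) _.
  move=> x [Ax xs]; case xb : (x (size s)).
    have [|k _ kx] := c1 x; first by split => //; apply/Ncyl_rcons.
    by exists k.*2.+1; rewrite // /t /= odd_double/= uphalf_double.
  have [|k _ kx] := c0 x; first by split => //; apply/Ncyl_rcons.
  by exists k.*2; rewrite // /t /= odd_double/= doubleK.
apply: lime_le; first by apply: is_cvg_nneseries => *.
apply: nearW => n.
apply: (@le_trans _ _ (\sum_(0 <= k < n.*2) wt (t k))%E).
  by apply: lee_sum_nneg_natr => //; rewrite -addnn leq_addr.
apply: (@le_trans _ _ (\sum_(0 <= k < n) wt (t0 k) + \sum_(0 <= k < n) wt (t1 k))%E).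
  elim: n => [|n IH]; first by rewrite !big_geq// adde0.
  rewrite doubleS (big_nat_recr n.*2.+1)//= (big_nat_recr n.*2)//= (big_nat_recr n)//=.
  rewrite (big_nat_recr n)//= addeACA addeA.
  by rewrite /t /= odd_double/= doubleK uphalf_double !leeD.
by apply: leeD; apply: nneseries_lim_ge.
Qed.

End CoinTossing.

(** * Relative measure in a cylinder *)

Section RelativeMeasure.
Variable R : realType.
Implicit Types (A B : set X) (s t : seq bool).

(** [dens_seq R A z n] unfolds to [rel_mu A (restr z n)], which turns densities into a function on
    finite words. *)
Definition rel_mu A s : R := fine (mu R (A `&` Ncyl s)) / fine (mu R (Ncyl s)).

Lemma mu_fin A s : mu R (A `&` Ncyl s) \is a fin_num.
Proof.
rewrite ge0_fin_numE ?mu_ge0//; apply: le_lt_trans (mu_le R (@subIsetr _ _ _)) _.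
by rewrite mu_Ncyl ltry.
Qed.

Lemma rel_muE A s : rel_mu A s = fine (mu R (A `&` Ncyl s)) * 2%:R ^+ size s.
Proof. by rewrite /rel_mu mu_Ncyl /= invrK. Qed.

Lemma rel_mu_ge0 A s : 0 <= rel_mu A s.
Proof. by rewrite rel_muE mulr_ge0 ?exprn_ge0// fine_ge0// mu_ge0. Qed.

Lemma rel_mu_le1 A s : rel_mu A s <= 1.
Proof.
rewrite /rel_mu ler_pdivrMr ?mul1r.
  by apply: fine_le (mu_fin A s) _ (mu_le R (@subIsetr _ _ _)); rewrite mu_Ncyl.
by rewrite mu_Ncyl /= invr_gt0 exprn_gt0.
Qed.

Lemma rel_mu_split A s :
  rel_mu A s = (rel_mu A (rcons s false) + rel_mu A (rcons s true)) / 2.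
Proof.
rewrite !rel_muE mu_split fineD ?mu_fin// !size_rcons exprS -mulrDl.
by rewrite -mulrA [2 * _]mulrC mulfK.
Qed.

Lemma eq_rel_mu A B s : A `&` Ncyl s = B `&` Ncyl s -> rel_mu A s = rel_mu B s.
Proof. by rewrite /rel_mu => ->. Qed.

Lemma rel_mu_cyl A s t : A `&` Ncyl s = Ncyl t ->
  rel_mu A s = 2%:R ^+ size s / 2%:R ^+ size t.
Proof. by move=> h; rewrite rel_muE h mu_Ncyl mulrC. Qed.

Lemma rel_mu1 A s : Ncyl s `<=` A -> rel_mu A s = 1.
Proof. by move=> h; rewrite (@rel_mu_cyl _ _ s) ?divff ?expf_neq0//; exact: setIidr. Qed.

Lemma rel_mu0 A s : A `&` Ncyl s = set0 -> rel_mu A s = 0.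
Proof. by rewrite rel_muE => ->; rewrite mu0 mul0r. Qed.

End RelativeMeasure.

(** * Combs *)

Implicit Types (x y z c : X) (s t u : seq bool) (E : seq bool -> set X).
Implicit Types (f : X -> X) (F : X -> X -> Prop) (D : set X).

Definition evens (x : X) : X := fun n => x n.*2.
Definition spine (z : X) : X := fun n => if odd n then true else z n./2.
Definition shift (n : nat) (x : X) : X := fun i => x (n + i)%N.
(** The words [node t] are the prefixes of even length of spine points. *)
Definition node (t : seq bool) : seq bool := flatten [seq [:: b; true] | b <- t].

(* A point leaves the spine at the first odd position carrying [false]; the
   rest of it must then belong to the set attached to the bits read so far. *)
Definition comb (E : seq bool -> set X) : set X :=
  [set x : X | forall n, (forall m, (m < n)%N -> x m.*2.+1) -> ~~ x n.*2.+1 ->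
           E (restr (evens x) n.+1) (shift n.+1.*2 x)].

Lemma spine_even z n : spine z n.*2 = z n.
Proof. by rewrite /spine odd_double doubleK. Qed.

Lemma evens_spine z : evens (spine z) = z.
Proof. by apply/funext => n; exact: spine_even. Qed.

Lemma spine_odd z n : spine z n.*2.+1.
Proof. by rewrite /spine /= odd_double. Qed.

Lemma spine_evens x : (forall n, x n.*2.+1) -> spine (evens x) = x.
Proof.
move=> h; apply/funext => n; rewrite /spine /evens.
rewrite -[in RHS](odd_double_half n); case: ifP => _; first by rewrite h.
by rewrite add0n.
Qed.

Lemma node_rcons t b : node (rcons t b) = rcons (rcons (node t) b) true.
Proof. by rewrite /node map_rcons flatten_rcons -!cats1 -catA. Qed.

Lemma size_node t : size (node t) = (size t).*2.
Proof. by elim: t => //= b t ->. Qed.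

Lemma restr_spine z n : restr (spine z) n.*2 = node (restr z n).
Proof.
elim: n => // n IH; rewrite doubleS !restrS IH node_rcons.
by rewrite /spine /= odd_double doubleK.
Qed.

Lemma Ncyl_node t x :
  Ncyl (node t) x <-> restr (evens x) (size t) = t /\
                      forall m, (m < size t)%N -> x m.*2.+1.
Proof.
elim/last_ind: t => [|t b IH]; first by rewrite Ncyl_nil.
rewrite node_rcons size_rcons; split.
  move=> /Ncyl_rcons[/Ncyl_rcons[/IH[xt xm] xb]].
  rewrite size_rcons size_node in xb * => x1.
  split; first by rewrite restrS xt /evens xb.
  by move=> m; rewrite ltnS leq_eqVlt => /predU1P[->//|/xm].
rewrite restrS => -[/rcons_inj[xt xb] xm].
apply/Ncyl_rcons; split; last by rewrite size_rcons size_node; apply: xm.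
by apply/Ncyl_rcons; rewrite size_node; split => //; apply/IH; split => // m /ltnW/xm.
Qed.

Lemma spine_comb E z : comb E (spine z).
Proof. by move=> n _; rewrite spine_odd. Qed.

Lemma comb_exit E t b x : Ncyl (rcons (rcons (node t) b) false) x ->
  comb E x <-> E (rcons t b) (shift (size t).+1.*2 x).
Proof.
move=> /Ncyl_rcons[/Ncyl_rcons[/Ncyl_node[xt xm] xb]].
rewrite size_rcons size_node in xb * => x0.
have xtb : restr (evens x) (size t).+1 = rcons t b by rewrite restrS xt /evens xb.
split=> [/(_ (size t) xm)|h n nx n0].
  by rewrite x0 xtb; apply.
have -> : n = size t; last by rewrite xtb.
apply/eqP; rewrite eqn_leq; apply/andP; split; rewrite leqNgt; apply/negP => /[dup] lt.
  by move=> /nx; rewrite x0.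
by move=> /xm; rewrite (negbTE n0).
Qed.

(** The first [L] bits decide membership, so these are the clopen sets. *)
Definition local_set (A : set X) :=
  exists L, forall x : X, A x -> Ncyl (restr x L) `<=` A.

(** * Densities of a comb on and off its spine *)

Section Comb.
Variables (R : realType) (E : seq bool -> set X) (v : seq bool -> R).
(** [v t] is the measure of [E t], required of its copy in every cylinder, so that scaling
    invariance of [mu] is not called upon. *)
Hypothesis Ev : forall t s, rel_mu R [set x | E t (shift (size s) x)] s = v t.
Hypothesis Eloc : forall t, local_set (E t).

Local Notation K := (comb E).
Local Notation d := (rel_mu R K).

Lemma rel_mu_exit t b : d (rcons (rcons (node t) b) false) = v (rcons t b).
Proof.
rewrite -(Ev _ (rcons (rcons (node t) b) false)); apply: eq_rel_mu.
rewrite !size_rcons size_node.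
by apply/seteqP; split=> x [h xN]; split=> //; apply/(comb_exit E xN).
Qed.

Lemma rel_mu_step t b :
  d (rcons (node t) b) = (v (rcons t b) + d (node (rcons t b))) / 2.
Proof. by rewrite rel_mu_split rel_mu_exit node_rcons. Qed.

(** The density at a node is a weighted average of the exit values below it: the exits of the next
    [j] levels carry weight [1 - 2 ^- j], and the remainder errs by at most [2 ^- j]. *)
Lemma node_close (l e : R) j t : 0 <= l <= 1 -> 0 <= e ->
  (forall u, (0 < size u <= j)%N -> `|v (t ++ u) - l| <= e) ->
  `|d (node t) - l| <= e + 2%:R ^- j.
Proof.
move=> /andP[l0 l1] e0; elim: j t => [|j IH] t vt.
  apply: (@le_trans _ _ 1); last by rewrite expr0 invr1 lerDr.
  have := rel_mu_ge0 R K (node t); have := rel_mu_le1 R K (node t).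
  by move=> d1 d0; rewrite ler_norml; apply/andP; split; lra.
have stp b : `|d (rcons (node t) b) - l| <= e + 2%:R ^- j.+1.
  have v1 : `|v (rcons t b) - l| <= e by rewrite -cats1 vt.
  have d1 : `|d (node (rcons t b)) - l| <= e + 2%:R ^- j.
    apply: IH => u /andP[u0 uj]; rewrite cat_rcons; apply: vt => //=.
  rewrite rel_mu_step exprS invfM.
  move: v1 d1; rewrite !ler_norml => /andP[? ?] /andP[? ?].
  by apply/andP; split; lra.
rewrite rel_mu_split; move: (stp false) (stp true); rewrite !ler_norml.
by move=> /andP[? ?] /andP[? ?]; apply/andP; split; lra.
Qed.

(** The words [u] leaving [z] matter because the density at a node averages over all of them; those
    longer than [n] only contribute [2 ^- n]. *)
Definition settles (z : X) (l : R) := forall e, 0 < e -> exists N, forall n,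
  (N <= n)%N -> forall u, (0 < size u <= n)%N -> `|v (restr z n ++ u) - l| <= e.

Definition wavers (z : X) := exists2 e, 0 < e & forall N, exists2 n,
  (N <= n)%N & e <= `|v (restr z n.+1) - v (restr z n.+2)|.

Lemma settles_cvg z l : 0 <= l <= 1 -> settles z l ->
  dens_seq R K (spine z) @ \oo --> l.
Proof.
move=> l01 zl; apply/cvgrPdist_le => e e0.
have e20 : 0 < e / 2 by rewrite divr_gt0.
have [N Nz] := zl _ e20.
have [M small] := small_halves e20.
have close n : (maxn N M <= n)%N -> `|d (node (restr z n)) - l| <= e.
  rewrite geq_max => /andP[Nn Mn].
  apply: le_trans (@node_close l (e / 2) n _ l01 (ltW e20) (Nz _ Nn)) _.
  by rewrite [leRHS]splitr lerD2l small.
exists (maxn N M).+1.*2 => // n /= nN.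
rewrite distrC /dens_seq -/(rel_mu R K _).
have nE := odd_double_half n.
have hn1 : (maxn N M < n./2)%N by rewrite -(doubleK (maxn N M).+1) half_leq.
have hn := ltnW hn1.
(* A prefix of even length is a node; at odd length the density is the mean of one exit value and
   the next node's density. *)
case on : (odd n) in nE; rewrite -nE ?add0n ?restr_spine; last exact: close.
rewrite add1n restrS restr_spine rel_mu_step spine_even -restrS.
have := close n./2.+1 (leq_trans hn (leqnSn _)).
have : `|v (restr z n./2.+1) - l| <= e.
  apply: (@le_trans _ _ (e / 2)); last by lra.
  rewrite restrS -cats1; apply: Nz.
    by apply: leq_trans hn; rewrite leq_maxl.
  by rewrite /= (leq_ltn_trans _ hn1).
rewrite !ler_norml => /andP[? ?] /andP[? ?].
by apply/andP; split; lra.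
Qed.

(** An exit value is twice one density minus the next, so convergence of the densities would force
    the exit values to converge. *)
Lemma wavers_ncvg z : wavers z -> ~ cvgn (dens_seq R K (spine z)).
Proof.
case=> e e0 zw /cvg_ex[/= l /cvgrPdist_lt dl].
(* Densities within [e / 8] of [l] put exit values within [3 * (e / 8)], so two of them differ by
   less than [e]. *)
have e8 : 0 < e / 8 by rewrite divr_gt0.
have [N _ Nd] := dl _ e8.
have vE n : v (restr z n.+1) =
    2 * d (restr (spine z) n.*2.+1) - d (restr (spine z) n.+1.*2).
  rewrite [restr (spine z) _.+1]restrS !restr_spine spine_even rel_mu_step -restrS.
  by lra.
have vl n : (N <= n)%N -> `|v (restr z n.+1) - l| < 3 * (e / 8).
  move=> Nn; rewrite vE.
  have N1 : (N <= n.*2)%N by rewrite (leq_trans Nn)// -addnn leq_addr.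
  have := Nd n.*2.+1 (leq_trans N1 (leqnSn _)).
  have := Nd n.+1.*2 (leq_trans N1 (leq_trans (leqnSn _) (leqnSn _))).
  rewrite /dens_seq -!/(rel_mu R K _) !ltr_norml => /andP[? ?] /andP[? ?].
  by apply/andP; split; lra.
have [n Nn] := zw N.
have := vl n Nn; have := vl n.+1 (leq_trans Nn (leqnSn _)).
rewrite !ltr_norml leNgt => /andP[? ?] /andP[? ?] /negP; apply.
by rewrite ltr_norml; apply/andP; split; lra.
Qed.

(** After the first exit, membership is decided by finitely many further bits, so the density
    sequence is eventually constant. *)
Lemma offspine_cvg x : (exists n, ~~ x n.*2.+1) ->
  exists2 l : R, l = 0 \/ l = 1 & dens_seq R K x @ \oo --> l.
Proof.
move=> ex; pose n := ex_minn ex.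
have [n0 xm] : ~~ x n.*2.+1 /\ forall m, (m < n)%N -> x m.*2.+1.
  rewrite /n; case: ex_minnP => k k0 kmin; split => // m; rewrite ltnNge.
  by apply: contraNT => /kmin.
pose t := restr (evens x) n; pose b := evens x n.
have xN : Ncyl (rcons (rcons (node t) b) false) x.
  apply/Ncyl_rcons; rewrite size_rcons size_node size_restr; split; last exact/negbTE.
  apply/Ncyl_rcons; rewrite size_node size_restr; split => //.
  by apply/Ncyl_node; rewrite size_restr.
have sN : size (rcons (rcons (node t) b) false) = n.+1.*2.
  by rewrite !size_rcons size_node size_restr.
have [L EL] := Eloc (rcons t b).
have inN m y : (n.+1.*2 + L <= m)%N -> Ncyl (restr x m) y ->
    Ncyl (rcons (rcons (node t) b) false) y /\
    Ncyl (restr (shift n.+1.*2 x) L) (shift n.+1.*2 y).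
  move=> nm /Ncyl_restr yx; split.
    rewrite -(iffLR (NcylP _ _) xN) sN; apply/Ncyl_restr => i il; apply: yx.
    by rewrite (leq_trans il)// (leq_trans _ nm)// leq_addr.
  apply/Ncyl_restr => i il; rewrite /shift yx// (leq_trans _ nm)//.
  by rewrite ltn_add2l.
have [Kx|nKx] := pselect (K x).
  exists 1; first by right.
  apply: cvg_near_cst; exists (n.+1.*2 + L)%N => // m /= nm.
  apply: rel_mu1 => y /(inN _ _ nm)[yN yx].
  apply/(comb_exit E yN); move/(comb_exit E xN): Kx; rewrite size_restr.
  by move=> /EL; apply.
exists 0; first by left.
apply: cvg_near_cst; exists (n.+1.*2 + L)%N => // m /= nm.
apply: rel_mu0; rewrite -subset0 => y [Ky /(inN _ _ nm)[yN /Ncyl_restr yx]]; apply: nKx.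
apply/(comb_exit E xN); move/(comb_exit E yN): Ky; rewrite size_restr.
by move=> /EL; apply; apply/Ncyl_restr => i il; rewrite yx.
Qed.

(** The complement is open: a violation at exit [n] is visible in the first [n.+1.*2 + L] bits. *)
Lemma comb_compact : compact K.
Proof.
apply: (subclosed_compact _ cantor_space_compact) => // x Kx n nx n0.
have [L EL] := Eloc (restr (evens x) n.+1).
have /Kx[y [Ky /Ncyl_restr yx]] : nbhs x (Ncyl (restr x (n.+1.*2 + L))).
  by apply/nbhs_cantorP; exists (n.+1.*2 + L)%N.
have small i : (i < n.+1.*2)%N -> y i = x i.
  by move=> il; rewrite yx// (leq_trans il)// leq_addr.
have yt : restr (evens y) n.+1 = restr (evens x) n.+1.
  by apply/eq_restr/Ncyl_restr => i il; rewrite /evens small// ltn_double.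
have ny m : (m < n)%N -> y m.*2.+1.
  by move=> mn; rewrite small ?nx// doubleS ltnS ltnW// ltnS ltn_double.
have := Ky n ny; rewrite yt small; last by rewrite doubleS.
move=> /(_ n0)/EL; apply; apply/Ncyl_restr => i il.
by rewrite /shift yx// ltn_add2l.
Qed.

Lemma spine_or_off x : x = spine (evens x) \/ exists n, ~~ x n.*2.+1.
Proof.
have [h|/existsNP[n /negP h]] := pselect (forall n, x n.*2.+1).
  by left; rewrite spine_evens.
by right; exists n.
Qed.

Lemma Blur_comb (G : set X) : (forall z, G z -> wavers z) ->
  (forall z, ~ G z -> exists2 l, 0 <= l <= 1 & settles z l) ->
  Blur R K = spine @` G.
Proof.
move=> Gw Gs; apply/seteqP; split=> [x nx|_ [z Gz <-]].
  have [xE|/offspine_cvg[l _ xl]] := spine_or_off x; last first.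
    by case: nx; apply/cvg_ex; exists l.
  exists (evens x) => //; apply: contrapT => /Gs[l l01 /(settles_cvg l01) zl].
  by apply: nx; rewrite xE; apply/cvg_ex; exists l.
exact/wavers_ncvg/Gw.
Qed.

Lemma Sharp_comb (G : set X) : (forall z, ~ G z -> wavers z) ->
  (forall z, G z -> exists2 l, 0 < l < 1 & settles z l) ->
  Sharp R K = spine @` G.
Proof.
move=> Gw Gs; apply/seteqP; split=> [x [xc xl]|_ [z Gz <-]].
  have [xE|/offspine_cvg[l l01 /cvg_lim xL]] := spine_or_off x; last first.
    by move: xl; rewrite xL//; case: l01 => ->; rewrite ltxx// andbF.
  exists (evens x) => //; apply: contrapT => /Gw/wavers_ncvg; apply.
  by rewrite -xE.
have [l /andP[l0 l1] /settles_cvg zl] := Gs _ Gz.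
have {}zl : dens_seq R K (spine z) @ \oo --> l by apply: zl; rewrite !ltW.
by split; [apply/cvg_ex; exists l | rewrite (cvg_lim _ zl)// l0].
Qed.

End Comb.

(** * Exits governed by a rank function *)

Lemma Ncyl_cat s t x : Ncyl (s ++ t) x <-> Ncyl s x /\ Ncyl t (shift (size s) x).
Proof.
elim/last_ind: t => [|t b IH].
  by rewrite cats0 Ncyl_nil; split => [|[]].
rewrite -rcons_cat; split=> [/Ncyl_rcons[/IH[xs xt] xb]|[xs /Ncyl_rcons[xt xb]]].
  by split=> //; apply/Ncyl_rcons; split => //; rewrite -xb size_cat.
by apply/Ncyl_rcons; rewrite size_cat; split => //; apply/IH.
Qed.

Lemma Ncyl_nseq n b x : Ncyl (nseq n b) x <-> forall j, (j < n)%N -> x j = b.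
Proof.
rewrite /Ncyl /= size_nseq.
by split=> h j jn; move: (h j jn); rewrite nth_nseq jn.
Qed.

Lemma take_restr z n m : (m <= n)%N -> take m (restr z n) = restr z m.
Proof. by move=> mn; rewrite /restr /mkseq -map_take take_iota (minn_idPl mn). Qed.

Lemma take_restr_cat z n m u : (m <= n)%N -> take m (restr z n ++ u) = restr z m.
Proof. by move=> mn; rewrite takel_cat ?size_restr// take_restr. Qed.

Section Rank.
Variables (R : realType) (k : seq bool -> nat).
Hypothesis k_mono : forall t u, (k t <= k (t ++ u))%N.

Definition unbounded_rank : set X :=
  [set z | forall N, exists n, (N <= k (restr z n))%N].

Lemma rank_restr z m n : (m <= n)%N -> (k (restr z m) <= k (restr z n))%N.
Proof.
by move=> mn; rewrite -[in leqRHS](cat_take_drop m (restr z n)) take_restr.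
Qed.

Lemma bounded_rank z : ~ unbounded_rank z ->
  exists N, forall n, (k (restr z n) <= k (restr z N))%N.
Proof.
move=> /existsNP[B] /forallNP hB.
have kB n : (k (restr z n) <= B)%N by rewrite leqNgt; apply/negP => /ltnW/hB.
pose P j := `[< exists n, k (restr z n) = j >].
have exP : exists j, P j by exists (k (restr z 0)); apply/asboolP; exists 0%N.
have PB j : P j -> (j <= B)%N by move=> /asboolP[n <-].
case: (ex_maxnP exP PB) => j /asboolP[N <-] jmax.
by exists N => n; apply: jmax; apply/asboolP; exists n.
Qed.

(* The rank jump seen at a node of length [h] is only signalled at length [2h],
   so that it is invisible from the spine points branching off in between. *)
Definition jump (t : seq bool) : bool :=
  ~~ odd (size t) && (k (take (size t)./2 t) != k (take (size t)./2.-1 t)).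

Lemma jump_double z n :
  jump (restr z n.*2) = (k (restr z n) != k (restr z n.-1)).
Proof.
rewrite /jump size_restr odd_double doubleK !take_restr//.
  by rewrite (leq_trans (leq_pred _))// -addnn leq_addr.
by rewrite -addnn leq_addr.
Qed.

Definition blur_exit (t : seq bool) : set X := [set x | jump t].

Lemma blur_exit_measure t s :
  rel_mu R [set x | blur_exit t (shift (size s) x)] s = (jump t)%:R.
Proof.
rewrite /blur_exit /=; case: jump; first exact: rel_mu1.
by apply: rel_mu0; rewrite -subset0 => x [].
Qed.

Lemma blur_exit_local t : local_set (blur_exit t).
Proof. by exists 0%N => x h y _. Qed.

Lemma Blur_rank : Blur R (comb blur_exit) = spine @` unbounded_rank.
Proof.
apply: (Blur_comb blur_exit_measure blur_exit_local) => z zk.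
  exists 1 => // N; have [n nN] := zk (k (restr z N)).+1.
  have ex : exists n, (k (restr z N) < k (restr z n))%N by exists n.
  (* At the least [m] with larger rank the jump happens between [m.-1] and [m]: the exit at length
     [m.*2] is full, the one at the next, odd, length is empty. *)
  case: (ex_minnP ex) => m mN mmin.
  have Nm : (N < m)%N.
    by rewrite ltnNge; apply/negP => /(rank_restr z); rewrite leqNgt mN.
  case: m => // m in mN mmin Nm *.
  exists m.*2.+1; first by rewrite ltnW// ltnS -addnn (leq_trans _ (leq_addr _ _)).
  rewrite -doubleS jump_double [jump _](_ : _ = false); last first.
    by rewrite /jump size_restr /= odd_double.
  rewrite subr0 (_ : _ != _) ?normr1//; apply/eqP => mE.
  by have := mmin m; rewrite -mE mN ltnn => /(_ isT).
exists 0; first by rewrite lexx ler01.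
move=> e e0; have [N Nmax] := bounded_rank zk; exists N.+1.*2 => n Nn u /andP[u0 un].
rewrite (_ : jump _ = false) ?subrr ?normr0 1?ltW//.
rewrite /jump size_cat size_restr; apply/negP => /andP[_].
(* The jump test reads prefixes of length at most [h <= n], which belong to [z] itself whatever [u]
   is, and of length at least [N], where the rank is already maximal. *)
set h := (n + size u)./2.
have hn : (h <= n)%N.
  by rewrite -[leqRHS]doubleK -addnn half_leq// leq_add2l.
have Nh : (N < h)%N.
  by rewrite -[leqLHS](doubleK N.+1) half_leq// (leq_trans Nn) ?leq_addr.
have {}Nh : (N <= h.-1)%N by case: (h) Nh.
rewrite !take_restr_cat// ?(leq_trans (leq_pred _))// => /negP; apply.
rewrite eqn_leq; apply/andP; split.
  by apply: leq_trans (Nmax h) _; exact: rank_restr.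
by apply: rank_restr; exact: leq_pred.
Qed.

(** The alternatives are disjoint, so their measures [1/2] and, at even lengths, [2 ^- (k t).+2] add
    up. *)
Definition sharp_exit (t : seq bool) : set X :=
  [set x : X | x 0%N \/ ~~ odd (size t) /\ forall j, (j < (k t).+2)%N -> x j = false].

Definition sharp_value (t : seq bool) : R :=
  2^-1 + (if odd (size t) then 0 else 2%:R ^- (k t).+2).

Lemma sharp_exit_measure t s :
  rel_mu R [set x | sharp_exit t (shift (size s) x)] s = sharp_value t.
Proof.
set A := [set x | _].
have A1 : rel_mu R A (rcons s true) = 1.
  apply: rel_mu1 => x /Ncyl_rcons[_ xs]; left.
  by rewrite /shift addn0 xs.
have A0 : rel_mu R A (rcons s false) = if odd (size t) then 0 else 2%:R ^- (k t).+1.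
  case: ifP => ot.
    apply: rel_mu0; rewrite -subset0 => x [+ /Ncyl_rcons[_ xs]].
    by case=> [|[]]; rewrite ?ot// /shift addn0 xs.
  rewrite (@rel_mu_cyl _ _ _ (s ++ nseq (k t).+2 false)).
    by rewrite size_rcons size_cat size_nseq -addSnnS exprD invfM mulrA divff ?mul1r.
  apply/seteqP; split=> [x [Ax /Ncyl_rcons[xs x0]]|x /Ncyl_cat[xs /Ncyl_nseq x0]].
    apply/Ncyl_cat; split => //; apply/Ncyl_nseq.
    by move: Ax; rewrite /A /= /sharp_exit /= {1}/shift addn0 x0 => -[|[]].
  split; last by apply/Ncyl_rcons; split => //; rewrite -(x0 0%N)// /shift addn0.
  by right; rewrite ot.
rewrite rel_mu_split A1 A0 /sharp_value; case: ifP => _; first by rewrite add0r addr0 mul1r.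
by rewrite [in RHS]exprS invfM; lra.
Qed.

Lemma sharp_exit_local t : local_set (sharp_exit t).
Proof.
exists (k t).+2 => x [x0 y /Ncyl_restr yx|[ot x0] y /Ncyl_restr yx].
  by left; rewrite yx.
by right; split => // j jk; rewrite yx ?x0.
Qed.

Lemma Sharp_rank : Sharp R (comb sharp_exit) = spine @` unbounded_rank.
Proof.
apply: (Sharp_comb sharp_exit_measure sharp_exit_local) => z zk.
  have [N Nmax] := bounded_rank zk.
  (* Consecutive lengths have opposite parity, so consecutive values differ by some [2 ^- (k _).+2],
     which the maximal rank bounds from below. *)
  have p (m : nat) : 2%:R ^- (k (restr z N)).+2 <= 2%:R ^- (k (restr z m)).+2 :> R.
    by rewrite lef_pV2 ?posrE ?exprn_gt0// ler_eXn2l ?ltr1n// !ltnS.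
  exists (2%:R ^- (k (restr z N)).+2) => [|M]; first by rewrite invr_gt0 exprn_gt0.
  exists M => //; rewrite /sharp_value !size_restr /= negbK opprD addrACA subrr add0r.
  by case: odd; rewrite /= ?subr0 ?sub0r ?normrN ger0_norm ?p//.
(* By monotonicity every extension of [restr z n] has rank at least [M], hence a value within [e] of
   [1/2]. *)
exists 2^-1; first by apply/andP; split; lra.
move=> e e0; have [M small] := small_halves e0.
have [N MN] := zk M; exists N => n Nn u _.
rewrite /sharp_value addrAC subrr add0r; case: ifP => _; first by rewrite normr0 ltW.
rewrite ger0_norm ?invr_ge0 ?exprn_ge0//; apply: small.
by rewrite (leq_trans MN)// !leqW// (leq_trans _ (k_mono _ _))// rank_restr.
Qed.

End Rank.

(** * Locally constant data and Gdelta graphs *)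

Definition locally_constant {T : Type} (f : X -> T) :=
  forall x, exists m, forall y, Ncyl (restr x m) y -> f y = f x.

Definition finitary (f : X -> X) := forall n, locally_constant (fun x => f x n).

Lemma locally_constant_comp {T U : Type} (g : T -> U) (f : X -> T) :
  locally_constant f -> locally_constant (g \o f).
Proof. by move=> h x; have [m fm] := h x; exists m => y /fm /= ->. Qed.

(** Serves [code_hit], where the position at which [c] is read depends on a prefix of [c]. *)
Lemma locally_constant_bind {T U : Type} (g : T -> X -> U) (f : X -> T) :
  locally_constant f -> (forall a, locally_constant (g a)) ->
  locally_constant (fun x => g (f x) x).
Proof.
move=> fl gl x; have [m fm] := fl x; have [n gn] := gl (f x) x.
exists (maxn m n) => y xy; rewrite fm ?gn//.
  by apply: Ncyl_restr_sub xy; rewrite leq_maxr.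
by apply: Ncyl_restr_sub xy; rewrite leq_maxl.
Qed.

Lemma locally_constant_pair {T U : Type} (f : X -> T) (g : X -> U) :
  locally_constant f -> locally_constant g ->
  locally_constant (fun x => (f x, g x)).
Proof.
move=> fl gl; apply: (locally_constant_bind (g := fun a x => (a, g x)) fl) => a.
exact: (locally_constant_comp (pair a) gl).
Qed.

Lemma locally_constant_cst {T : Type} (a : T) : locally_constant (fun=> a).
Proof. by move=> x; exists 0%N. Qed.

Lemma locally_constant_nth n : locally_constant (fun x => x n).
Proof. by move=> x; exists n.+1 => y /Ncyl_restr; apply. Qed.

Lemma locally_constant_restr n : locally_constant (fun x => restr x n).
Proof. by move=> x; exists n => y /eq_restr. Qed.

Lemma locally_constant_map {T U : Type} (f : T -> X -> U) (l : seq T) :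
  (forall i, locally_constant (f i)) ->
  locally_constant (fun x => [seq f i x | i <- l]).
Proof.
move=> fl; elim: l => [|a l IH]; first exact: locally_constant_cst.
exact: (locally_constant_comp (fun p => p.1 :: p.2) (locally_constant_pair (fl a) IH)).
Qed.

Lemma finitary_restr f n : finitary f -> locally_constant (fun x => restr (f x) n).
Proof. exact: locally_constant_map. Qed.

Lemma finitary_continuous f : finitary f -> continuous f.
Proof.
move=> ff x U /nbhs_cantorP[n nU]; have [m fm] := finitary_restr n ff x.
apply/nbhs_cantorP; exists m => y /fm xy; apply: nU.
by apply/NcylP; rewrite size_restr.
Qed.

Lemma finitary_reindex (r : nat -> nat) : finitary (fun x n => x (r n)).
Proof. by move=> n; exact: locally_constant_nth. Qed.

(* [code_hit c i t] looks at [c] itself as the first coordinate: the ranks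
   below describe the diagonal section of the Gdelta set coded by [c]. *)
Definition code_hit (c : X) (i : nat) (t : seq bool) : bool :=
  has id [seq c (pickle (i, (restr c m, take m t))) | m <- iota 0 (size t).+1].

(** Counts the leading indices [i] already hit by [t]; the cap at [size t] makes the rank depend on
    finitely many bits of [c]. *)
Definition code_rank (c : X) (t : seq bool) : nat :=
  find negb [seq code_hit c i t | i <- iota 0 (size t)].

Lemma code_hitP c i t : reflect
  (exists2 m, (m <= size t)%N & c (pickle (i, (restr c m, take m t))))
  (code_hit c i t).
Proof.
apply: (iffP hasP) => [[_ /mapP[m + ->] mc]|[m mt mc]].
  by rewrite mem_iota /= => mt; exists m.
by exists true => //; apply/mapP; exists m; rewrite ?mem_iota ?mc.
Qed.

Lemma code_rankP c n t :
  reflect ((n <= size t)%N /\ forall i, (i < n)%N -> code_hit c i t)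
          (n <= code_rank c t)%N.
Proof.
have nthE i : (i < size t)%N ->
    nth true [seq code_hit c i t | i <- iota 0 (size t)] i = code_hit c i t.
  by move=> it; rewrite (nth_map 0%N) ?size_iota// nth_iota.
apply: (iffP idP) => [nk|[nt nh]].
  have nt : (n <= size t)%N.
    apply: leq_trans nk _; rewrite -[leqRHS](size_iota 0).
    by rewrite -(size_map (code_hit c ^~ t)) find_size.
  split=> // i i_n; have := before_find true (leq_trans i_n nk).
  by rewrite nthE ?(leq_trans i_n nt)// => /negbFE.
rewrite leqNgt; apply/negP => kn.
have kt : (code_rank c t < size t)%N := leq_trans kn nt.
have := nth_find true (a := negb) (s := [seq code_hit c i t | i <- iota 0 (size t)]).
rewrite has_find size_map size_iota => /(_ kt); rewrite -/(code_rank c t) nthE//.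
by rewrite nh.
Qed.

Lemma code_rank_mono c t u : (code_rank c t <= code_rank c (t ++ u))%N.
Proof.
apply/code_rankP; have /code_rankP[kt kh] := leqnn (code_rank c t).
split=> [|i /kh/code_hitP[m mt mc]]; first by rewrite size_cat (leq_trans kt)// leq_addr.
apply/code_hitP; exists m; first by rewrite size_cat (leq_trans mt)// leq_addr.
by rewrite takel_cat.
Qed.

Definition diag_section (c : X) : set X :=
  [set z | forall i : nat, exists m, c (pickle (i, (restr c m, restr z m)))].

Lemma unbounded_code_rank c : unbounded_rank (code_rank c) = diag_section c.
Proof.
apply/seteqP; split=> z zc.
  move=> i; have [n /code_rankP[_ /(_ i (leqnn _))/code_hitP[m]]] := zc i.+1.
  by rewrite size_restr => mn; rewrite take_restr//; exists m.
move=> N; have [m mP] := choice zc.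
(* Long enough to contain the witnesses for the first [N] indices and to lift the cap on the rank to
   [N]. *)
exists (maxn N (\max_(i < N) m i)); apply/code_rankP.
rewrite size_restr leq_maxl; split=> // i iN; apply/code_hitP; exists (m i).
  rewrite size_restr leq_max; apply/orP; right.
  exact: (leq_bigmax (Ordinal iN) (F := fun j : 'I_N => m j)).
rewrite take_restr// leq_max; apply/orP; right.
exact: (leq_bigmax (Ordinal iN) (F := fun j : 'I_N => m j)).
Qed.

Lemma code_rank_local t : locally_constant (fun c => code_rank c t).
Proof.
apply: (locally_constant_comp (find negb)); apply: locally_constant_map => i.
apply: (locally_constant_comp (has id)); apply: locally_constant_map => m.
apply: (locally_constant_bind (g := fun s x => x (pickle (i, (s, take m t))))).
  exact: locally_constant_restr.
by move=> s; exact: locally_constant_nth.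
Qed.

Lemma blur_exit_code t : locally_constant (fun c => blur_exit (code_rank c) t).
Proof.
apply: (locally_constant_comp (fun p : nat * nat =>
  [set x : X | ~~ odd (size t) && (p.1 != p.2)]) (locally_constant_pair _ _));
exact: code_rank_local.
Qed.

Lemma sharp_exit_code t : locally_constant (fun c => sharp_exit (code_rank c) t).
Proof.
apply: (locally_constant_comp (fun k : nat => [set x : X | x 0%N \/
  ~~ odd (size t) /\ forall j, (j < k.+2)%N -> x j = false])).
exact: code_rank_local.
Qed.

(** * Continuous dependence of the comb on its exits *)

Lemma locally_constant_short {T : Type} (F : seq bool -> X -> T) n x :
  (forall t, locally_constant (F t)) ->
  exists m, forall y, Ncyl (restr x m) y ->
    forall t, (size t <= n)%N -> F t y = F t x.
Proof.
elim: n F => [|n IH] F Fl.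
  by have [m Fm] := Fl [::] x; exists m => y /Fm xy [].
have [m Fm] := Fl [::] x.
have [m0 Fm0] := IH (fun t => F (false :: t)) (fun t => Fl _).
have [m1 Fm1] := IH (fun t => F (true :: t)) (fun t => Fl _).
exists (maxn m (maxn m0 m1)) => y xy.
have sub j : (j <= maxn m (maxn m0 m1))%N -> Ncyl (restr x j) y.
  by move=> jm; apply: Ncyl_restr_sub xy.
case=> [_|[] t tn]; first by apply: Fm; apply: sub; rewrite leq_maxl.
  by apply: Fm1 => //; apply: sub; rewrite !leq_max leqnn !orbT.
by apply: Fm0 => //; apply: sub; rewrite !leq_max leqnn !orbT.
Qed.

(** If [x] exits within the first [n] levels, only a word of length at most [n] constrains it, and
    [x] itself works; otherwise it agrees long enough with a spine point, which lies in every
    comb. *)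
Lemma comb_near E E' n x : (forall t, (size t <= n)%N -> E t = E' t) ->
  comb E x -> exists2 y, comb E' y & Ncyl (restr x n) y.
Proof.
move=> EE' Kx.
have [[j jn j0]|nj] := pselect (exists2 j, (j < n)%N & ~~ x j.*2.+1); last first.
  exists (spine (evens x)); first exact: spine_comb.
  apply/Ncyl_restr => i i_n; rewrite /spine /evens.
  rewrite -[in RHS](odd_double_half i); case: ifP => oi; rewrite ?add0n//.
  apply/esym/negPn/negP => xi; apply: nj; exists i./2 => //.
  by rewrite (leq_ltn_trans _ i_n)// -divn2 leq_div.
exists x; last exact: Ncyl_self.
move=> i xi i0; rewrite -EE'; first exact: Kx.
rewrite size_restr (leq_trans _ jn)// ltnS leqNgt; apply/negP => /xi.
by rewrite (negbTE j0).
Qed.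

Lemma compact_sub_open (K U : set X) : compact K -> open U -> K `<=` U ->
  exists n, forall x, K x -> Ncyl (restr x n) `<=` U.
Proof.
move=> /compact_near_coveringP cK oU KU.
have [|n _ nP] := cK nat \oo (fun n x => Ncyl (restr x n) `<=` U) _; last first.
  by exists n => x; apply: nP (leqnn n) _.
move=> x /KU Ux; have /nbhs_cantorP[m mU] := open_nbhs_nbhs (conj oU Ux).
exists (Ncyl (restr x m), [set n | m <= n]%N).
  by split; [apply/nbhs_cantorP; exists m | exists m].
by move=> [y n] [/= xy mn] z yz; apply: mU; exact: Ncyl_restr_trans yz.
Qed.

Definition seq_open (D : set X) :=
  forall x, D x -> exists m, Ncyl (restr x m) `<=` D.

(** For [c'] near [c] the exits at short words coincide, so each comb has points near every point of
    the other; one direction handles inclusion in [U], the other meeting [U]. *)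
Lemma comb_preimage_open (E : X -> seq bool -> set X) O :
  (forall t, locally_constant (fun c => E c t)) ->
  (forall c, compact (comb (E c))) ->
  vietoris_open O -> seq_open [set c | O (comb (E c))].
Proof.
move=> El Ec [OK Oo] c /= Oc; have [l [lo [[_ Vl] VO]]] := Oo _ Oc.
suff [m lm] : exists m, forall c', Ncyl (restr c m) c' ->
    forall p, p \in l -> vietoris_subbasic p.1 p.2 (comb (E c')).
  by exists m => c' cc'; apply: VO; split; [exact: Ec | exact: lm].
have near n : exists m, forall c', Ncyl (restr c m) c' ->
    forall t, (size t <= n)%N -> E c' t = E c t.
  exact: (locally_constant_short (F := fun t c => E c t)).
elim: l lo Vl {VO} => [|[b U] l IH] lo Vl; first by exists 0%N.
have [|p pl|m lm] := IH; first by move=> p pl; apply: lo; rewrite inE pl orbT.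
  by apply: Vl; rewrite inE pl orbT.
suff [m' lm'] : exists m', forall c', Ncyl (restr c m') c' ->
    vietoris_subbasic b U (comb (E c')).
  exists (maxn m m') => c' cc' p; rewrite inE => /predU1P[->|]; last first.
    by apply: lm; apply: Ncyl_restr_sub cc'; rewrite leq_maxl.
  by apply: lm'; apply: Ncyl_restr_sub cc'; rewrite leq_maxr.
have oU : open U by apply: (lo (b, U)); rewrite mem_head.
have /= := Vl (b, U) (mem_head _ _); rewrite /vietoris_subbasic.
case: b {lo Vl} => [[_ KU]|[_ [x [Kx Ux]]]].
  have [n nU] := compact_sub_open (Ec c) oU KU; have [m' mE] := near n.
  exists m' => c' /mE cc'; split; [exact: Ec | move=> x Kx].
  have [y Ky /Ncyl_restr xy] := comb_near cc' Kx.
  by apply: nU Ky _ _; apply/Ncyl_restr => i il; rewrite xy.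
have /nbhs_cantorP[n nU] := open_nbhs_nbhs (conj oU Ux).
have [m' mE] := near n; exists m' => c' /mE cc'; split; first exact: Ec.
have [y Ky /nU Uy] := comb_near (fun t tn => esym (cc' t tn)) Kx.
by exists y; split.
Qed.

(** * Gdelta relations and sets with a Gdelta graph *)

Definition open2 (U : X -> X -> Prop) := forall x y, U x y ->
  exists m, forall x' y', Ncyl (restr x m) x' -> Ncyl (restr y m) y' -> U x' y'.

Definition Gdelta2 (F : X -> X -> Prop) := exists2 U : nat -> X -> X -> Prop,
  forall i, open2 (U i) & forall x y, F x y <-> forall i, U i x y.

Lemma Gdelta2_open F : open2 F -> Gdelta2 F.
Proof. by move=> oF; exists (fun=> F) => // x y; split=> // /(_ 0%N). Qed.

(** A closed relation is the intersection of its cylinder neighbourhoods. *)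
Lemma Gdelta2_closed F : open2 (fun x y => ~ F x y) -> Gdelta2 F.
Proof.
move=> cF; exists (fun i x y => exists x' y',
    [/\ Ncyl (restr x i) x', Ncyl (restr y i) y' & F x' y']) => [i x y|x y].
  move=> [x' [y' [xx' yy' F']]]; exists i => u w xu yw; exists x', y'.
  by rewrite (eq_restr xu) (eq_restr yw).
split=> [Fxy i|h]; first by exists x, y; split => //; exact: Ncyl_self.
apply: contrapT => /cF[m mF]; have [x' [y' [xx' yy']]] := h m.
exact: mF.
Qed.

Lemma Gdelta2_ext F F' : (forall x y, F x y <-> F' x y) -> Gdelta2 F -> Gdelta2 F'.
Proof.
by move=> FF' [U oU FU]; exists U => // x y; rewrite -FU; apply: iff_sym.
Qed.

Lemma Gdelta2_forall (F : nat -> X -> X -> Prop) :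
  (forall n, Gdelta2 (F n)) -> Gdelta2 (fun x y => forall n, F n x y).
Proof.
move=> FG; have [|U UP] := @choice _ _ (fun n (U : nat -> X -> X -> Prop) =>
    (forall i, open2 (U i)) /\ forall x y, F n x y <-> forall i, U i x y) _.
  by move=> n; have [U oU FU] := FG n; exists U.
exists (fun i => if unpickle i is Some (n, j) then U n j else fun _ _ => True).
  move=> i; case: unpickle => [[n j]|]; first exact: (UP n).1.
  by move=> x y _; exists 0%N.
move=> x y; split=> [h i|h n]; last first.
  by apply/(UP n).2 => j; have := h (pickle (n, j)); rewrite pickleK.
by case: unpickle => // -[n j]; apply: (iffLR ((UP n).2 x y)).
Qed.

Lemma Gdelta2_and F F' : Gdelta2 F -> Gdelta2 F' ->
  Gdelta2 (fun x y => F x y /\ F' x y).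
Proof.
move=> gF gF'; apply: (@Gdelta2_ext (fun x y => forall n, (if n is 0%N then F else F') x y)).
  by move=> x y; split=> [h|[Fxy Fxy'] []//]; split; [exact: (h 0%N) | exact: (h 1%N)].
by apply: Gdelta2_forall => -[].
Qed.

Lemma open2_comp F f : finitary f -> open2 F -> open2 (fun x y => F x (f y)).
Proof.
move=> ff oF x y /oF[m mF]; have [n fn] := finitary_restr m ff y.
exists (maxn m n) => x' y' xx' yy'; apply: mF.
  by apply: Ncyl_restr_sub xx'; rewrite leq_maxl.
apply/NcylP; rewrite size_restr fn//.
by apply: Ncyl_restr_sub yy'; rewrite leq_maxr.
Qed.

Lemma Gdelta2_comp F f : finitary f -> Gdelta2 F -> Gdelta2 (fun x y => F x (f y)).
Proof.
move=> ff [U oU FU]; exists (fun i x y => U i x (f y)) => [i|x y]; last exact: FU.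
exact: open2_comp.
Qed.

Lemma Gdelta2_clopen (p : X -> bool) : locally_constant p -> Gdelta2 (fun _ y => p y).
Proof.
move=> pl; apply: Gdelta2_open => x y py; have [m pm] := pl y.
by exists m => x' y' _ /pm ->.
Qed.

(* Every Borel set is of this form. *)
Definition Gdelta_graph (D : set X) := exists2 f : X -> X,
  Gdelta2 (fun x y => y = f x) & forall x, D x <-> f x 0%N.

(** [f x] is the constant sequence of the truth value of [D x]: one implication about [y 0] is an
    open condition, the other a closed one. *)
Lemma Gdelta_graph_open D : seq_open D -> Gdelta_graph D.
Proof.
move=> oD; exists (fun x _ => `[< D x >]); last by move=> x; split=> /asboolP.
apply: (@Gdelta2_ext (fun x y => (forall i, y i == y 0%N) /\
    ((y 0%N -> D x) /\ (~~ y 0%N -> ~ D x)))).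
  move=> x y; split=> [[yi [y1 y0]]|->]; last first.
    by split=> //=; split=> [/asboolP|/asboolPn].
  apply/funext => i; rewrite (eqP (yi i)).
  by apply/idP/asboolP => [/y1//|Dx]; apply/negPn/negP => /y0.
apply: Gdelta2_and.
  apply: Gdelta2_forall => i; apply: Gdelta2_clopen.
  by move=> x; exists i.+1 => z /Ncyl_restr xz; rewrite !xz.
apply: Gdelta2_and.
  apply: Gdelta2_open => x y; case y0 : (y 0%N).
    move=> /(_ isT)/oD[m mD]; exists m => x' y' xx' _ _; exact: mD.
  by move=> _; exists 1%N => x' y' _ /Ncyl_restr/(_ 0%N isT) ->; rewrite y0.
apply: Gdelta2_closed => x y /not_implyP[y0 /contrapT/oD[m mD]].
exists m.+1 => x' y' xx' /Ncyl_restr/(_ 0%N isT) y'0; apply/not_implyP.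
rewrite y'0; split=> // => /(_ (mD _ _)); apply.
exact: Ncyl_restr_sub xx'.
Qed.

Lemma Gdelta_graph_setC D : Gdelta_graph D -> Gdelta_graph (~` D).
Proof.
case=> f gf fD; pose flip x : X := fun n => if n is 0%N then ~~ x 0%N else x n.
have flipK : involutive flip.
  by move=> x; apply/funext => -[|n] //=; rewrite negbK.
exists (flip \o f); last by move=> x; rewrite /= -(rwP negP) fD.
apply: (@Gdelta2_ext (fun x y => flip y = f x)).
  by move=> x y /=; split=> [<-|->]; rewrite flipK.
apply: (@Gdelta2_comp (fun x y => y = f x)) => // -[|n].
  exact: (locally_constant_comp negb (locally_constant_nth 0)).
exact: locally_constant_nth.
Qed.

(** [g x] stores all the [f n x] behind a leading bit for the union. With these witnesses kept
    inside [y], the condition on that bit mentions [y] only. *)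
Lemma Gdelta_graph_bigcup (D : nat -> set X) :
  (forall n, Gdelta_graph (D n)) -> Gdelta_graph (\bigcup_n D n).
Proof.
move=> gD; have [|f fP] := @choice _ _ (fun n (f : X -> X) =>
    Gdelta2 (fun x y => y = f x) /\ forall x, D n x <-> f x 0%N) _.
  by move=> n; have [f gf fD] := gD n; exists f.
pose slice (n : nat) y : X := fun j => y (pickle (n, j)).+1.
have slice_fin n : finitary (slice n) by exact: finitary_reindex.
(* [pickle_inv] singles out the exact range of [pickle]; elsewhere the bit is fixed to [false], so
   that the slices determine [y]. *)
pose g x : X := fun p => if p is q.+1 then
    (if pickle_inv q is Some (n, j) then f n x j else false)
  else `[< exists n, f n x 0%N >].
exists g; last first.
  move=> x; split=> [[n _ /(fP n).2 fn]|/asboolP[n fn]]; first by apply/asboolP; exists n.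
  by exists n => //; apply/(fP n).2.
apply: (@Gdelta2_ext (fun x y => (forall n, slice n y = f n x) /\
  ((forall q, (@pickle_inv (nat * nat)%type q == None) ==> ~~ y q.+1) /\
   ((y 0%N -> exists n, slice n y 0%N) /\ (forall n, slice n y 0%N -> y 0%N))))).
  move=> x y; split=> [[sy [yN [y1 y0]]]|->].
    apply/funext => -[|q] /=.
      apply/idP/asboolP => [/y1[n]|[n]]; first by rewrite sy; exists n.
      by rewrite -sy; exact: y0.
    case e : pickle_inv => [[n j]|]; last by apply/negbTE/(implyP (yN q)); rewrite e.
    rewrite -sy /slice; have := @pickle_invK (nat * nat)%type q.
    by rewrite /oapp e => ->.
  have gs n : slice n (g x) = f n x.
    by apply/funext => j; rewrite /slice /= pickleK_inv.
  split=> //; split; first by move=> q; apply/implyP => /eqP /= ->.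
  split=> [/asboolP[n fn]|n]; first by exists n; rewrite gs.
  by rewrite gs => fn; apply/asboolP; exists n.
apply: Gdelta2_and.
  apply: Gdelta2_forall => n.
  by apply: (@Gdelta2_comp (fun x y => y = f n x)) => //; exact: (fP n).1.
apply: Gdelta2_and.
  apply: Gdelta2_forall => q; apply: Gdelta2_clopen.
  exact: (locally_constant_comp (fun b => _ ==> ~~ b) (locally_constant_nth _)).
apply: Gdelta2_and.
  apply: Gdelta2_open => x y; case y0 : (y 0%N); last first.
    by move=> _; exists 1%N => x' y' _ /Ncyl_restr/(_ 0%N isT) ->; rewrite y0.
  move=> /(_ isT)[n ny]; exists (pickle (n, 0%N)).+2 => x' y' _ /Ncyl_restr yy' _.
  by exists n; rewrite /slice yy'.
apply: Gdelta2_forall => n; apply: (@Gdelta2_ext (fun _ y => slice n y 0%N ==> y 0%N)).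
  by move=> x y; split=> /implyP.
apply: Gdelta2_clopen => x; exists (pickle (n, 0%N)).+2 => y /Ncyl_restr xy.
by rewrite /slice !xy.
Qed.

(** * Diagonalization *)

(** [c] records, for each [i], the products of cylinders contained in [U i]; openness provides one
    around each point. *)
Lemma Gdelta2_code F : Gdelta2 F -> exists c, forall x z,
  F x z <-> forall i : nat, exists m, c (pickle (i, (restr x m, restr z m))).
Proof.
case=> U oU FU; exists (fun p => if unpickle p is Some (i, (s, t)) then
  `[< forall x z, Ncyl s x -> Ncyl t z -> U i x z >] else false) => x z.
rewrite FU; split=> h i.
  have [m mU] := oU i _ _ (h i); exists m; rewrite pickleK; apply/asboolP.
  exact: mU.
by have [m] := h i; rewrite pickleK => /asboolP; apply; exact: Ncyl_self.
Qed.

(** * Pairing of sequences and homeomorphic copies *)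

Definition odds (x : X) : X := fun n => x n.*2.+1.
Definition interleave (x y : X) : X := fun n => if odd n then y n./2 else x n./2.

Lemma evens_interleave x y : evens (interleave x y) = x.
Proof. by apply/funext => n; rewrite /evens /interleave odd_double doubleK. Qed.

Lemma odds_interleave x y : odds (interleave x y) = y.
Proof. by apply/funext => n; rewrite /odds /interleave /= odd_double uphalf_double. Qed.

Lemma interleaveK x : interleave (evens x) (odds x) = x.
Proof.
apply/funext => n; rewrite /interleave /evens /odds.
by rewrite -[in RHS](odd_double_half n); case: ifP => _; rewrite ?add0n ?add1n.
Qed.

(** Bit [0] of [z] is also bit [0] of [evens z], so once [evens z = f x] it tells which of the two
    compact sets [odds z] must lie in. *)
Lemma Gdelta2_odds (H : set X) (b : bool) : closed H ->
  Gdelta2 (fun _ z => z 0%N = b -> H (odds z)).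
Proof.
move=> cH; apply: Gdelta2_closed => x z /not_implyP[z0 nH].
have [m mH] : exists m, Ncyl (restr (odds z) m) `<=` ~` H.
  by apply/nbhs_cantorP/open_nbhs_nbhs; split => //; exact: closed_openC.
exists m.+1.*2 => _ y _ /Ncyl_restr zy; apply/not_implyP; split; first by rewrite zy.
by apply: mH; apply/Ncyl_restr => i im; rewrite /odds zy// doubleS ltnS ltnW// ltnS ltn_double.
Qed.

Lemma homeomorphic_sym (A B : set X) : homeomorphic A B -> homeomorphic B A.
Proof. by case=> f [g [? [? [? [? []]]]]]; exists g, f. Qed.

Lemma homeomorphic_trans (A B C : set X) :
  homeomorphic A B -> homeomorphic B C -> homeomorphic A C.
Proof.
have comp (P Q : set X) (f g : X -> X) : (forall x, P x -> Q (f x)) ->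
    {within P, continuous f} -> {within Q, continuous g} ->
    {within P, continuous (g \o f)}.
  move=> PQ /subspace_continuousP fc /subspace_continuousP gc.
  apply/subspace_continuousP => x Px U /(gc _ (PQ _ Px)) /(fc _ Px).
  rewrite /nbhs /= /within /= => h; apply: filterS h => y h Py; exact: h Py (PQ _ Py).
case=> f [f' [fA [fB [fK [f'K [fc f'c]]]]]] [g [g' [gB [gC [gK [g'K [gc g'c]]]]]]].
exists (g \o f), (f' \o g'); do !split.
- by move=> x /fA/gB.
- by move=> x /gC/fB.
- by move=> x Ax /=; rewrite gK ?fK//; exact: fA.
- by move=> x Cx /=; rewrite f'K ?g'K//; exact: gC.
- exact: comp fA fc gc.
- exact: comp gC g'c f'c.
Qed.

Lemma homeomorphic_slice y (H : set X) :
  homeomorphic (spine @` [set z | evens z = y /\ H (odds z)]) H.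
Proof.
exists (fun w => odds (evens w)), (fun h => spine (interleave y h)); do !split.
- by move=> _ [z [_ Hz] <-]; rewrite evens_spine.
- move=> h Hh; exists (interleave y h) => //=.
  by rewrite evens_interleave odds_interleave.
- by move=> _ [z [<- _] <-]; rewrite evens_spine interleaveK.
- by move=> h _; rewrite evens_spine odds_interleave.
- by apply/continuous_subspaceT/finitary_continuous => n; exact: locally_constant_nth.
- apply/continuous_subspaceT/finitary_continuous => n; rewrite /spine /interleave.
  case: odd; first exact: locally_constant_cst.
  by case: odd; [exact: locally_constant_nth | exact: locally_constant_cst].
Qed.

(* Diagonalization: a Borel [B] separating the two classes would make
   [D = {c | comb (E c) in B}] Borel; code by [c] the Gdelta set whose section
   at [x] is a copy of [H'] if [x] is in [D] and of [H] otherwise, and ask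
   whether [c] is in [D]. *)
Lemma diag_inseparable (Op : set X -> set X) (E : X -> seq bool -> set X)
    (H H' : set X) :
  (forall t, locally_constant (fun c => E c t)) ->
  (forall c, compact (comb (E c))) ->
  (forall c, Op (comb (E c)) = spine @` diag_section c) ->
  compact H -> compact H' ->
  borel_inseparable [set K | Kspace K /\ homeomorphic (Op K) H]
                    [set K | Kspace K /\ homeomorphic (Op K) H'].
Proof.
move=> El Ec OpE cH cH' [B [BB [HB BH']]].
have [f gf fD] : Gdelta_graph [set c | B (comb (E c))].
  (* Sets [O] whose preimage has a Gdelta graph form a sigma-algebra containing the open sets, hence
     include [B]. *)
  apply: (BB [set O : set (set X) | Gdelta_graph [set c | O (comb (E c))]]).
  split=> [|O oO]; last exact/Gdelta_graph_open/comb_preimage_open.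
  split=> [|O gO|O gO].
  - by apply: Gdelta_graph_open => x [].
  - rewrite /= (_ : [set c | _] = ~` [set c | O (comb (E c))]); first exact: Gdelta_graph_setC.
    by apply/seteqP; split=> c; [case | split => //; exact: Ec].
  - rewrite /= (_ : [set c | _] = \bigcup_n [set c | O n (comb (E c))]).
      exact: Gdelta_graph_bigcup.
    by apply/seteqP; split=> c.
have [c cP] : exists c, forall x z, (evens z = f x /\
    ((z 0%N = true -> H' (odds z)) /\ (z 0%N = false -> H (odds z)))) <->
    forall i : nat, exists m, c (pickle (i, (restr x m, restr z m))).
  apply: Gdelta2_code; apply: Gdelta2_and.
    apply: (@Gdelta2_comp (fun x y => y = f x)) => //.
    exact: (finitary_reindex double).
  by apply: Gdelta2_and; apply: Gdelta2_odds; apply: compact_closed => //;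
    exact: cantor_space_hausdorff.
have secE : diag_section c =
    [set z | evens z = f c /\ (if f c 0%N then H' else H) (odds z)].
  apply/seteqP; split=> z; rewrite /diag_section /=.
    move=> /(iffRL (cP c z))[zf]; rewrite -zf /evens /=.
    by case: (z 0%N) => -[h1 h0]; split => //; [exact: h1 | exact: h0].
  case=> zf h; apply/(cP c z); split => //; move: h; rewrite -zf /evens /=.
  by move=> h; split=> z0; move: h; rewrite z0.
have homK := homeomorphic_slice (f c) (if f c 0%N then H' else H).
rewrite -secE -OpE in homK.
have DcE := fD c.
(* If [c] is in [D], the comb is in [B] yet yields a copy of [H']; if not, it yields a copy of [H]
   and so lies in [B] after all. *)
case: (f c 0%N) homK DcE => homK [Dc cD].
  suff : (B `&` [set K | Kspace K /\ homeomorphic (Op K) H']) (comb (E c)) by rewrite BH'.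
  by split; [exact: cD | split => //; exact: Ec].
by have := Dc (HB _ (conj (Ec c) homK)).
Qed.

Lemma homeomorphic_classes_disjoint (Op : set X -> set X) (H H' : set X) :
  ~ homeomorphic H H' ->
  [set K | Kspace K /\ homeomorphic (Op K) H] `&`
  [set K | Kspace K /\ homeomorphic (Op K) H'] = set0.
Proof.
move=> nHH'; rewrite -subset0 => K [[_ KH] [_ KH']]; apply: nHH'.
exact: homeomorphic_trans (homeomorphic_sym KH) KH'.
Qed.

Theorem theorem6p7 (R : realType) (H H' : set cantor_space) :
  compact H -> compact H' -> ~ homeomorphic H H' ->
  (Shrp R H `&` Shrp R H' = set0 /\ borel_inseparable (Shrp R H) (Shrp R H')) /\
  (Blr R H `&` Blr R H' = set0 /\ borel_inseparable (Blr R H) (Blr R H')).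
Proof.
move=> cH cH' nHH'; split; split; try exact: homeomorphic_classes_disjoint.
  apply: (diag_inseparable sharp_exit_code) => // c.
    exact: (comb_compact (sharp_exit_local (code_rank c))).
  by rewrite Sharp_rank ?unbounded_code_rank//; exact: code_rank_mono.
apply: (diag_inseparable blur_exit_code) => // c.
  exact: (comb_compact (blur_exit_local (code_rank c))).
by rewrite Blur_rank ?unbounded_code_rank//; exact: code_rank_mono.
Qed.
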